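(* (Lifted Poincaré inequality) Let $L_0^2(\mu)=\mathbb H^l\oplus\mathbb H^h$ be an orthogonal decomposition into closed subspaces, with orthogonal projection $\Pi\colon L_0^2(\mu)\to\mathbb H^l$. Let $(\mathcal E,\mathrm{Dom}(\mathcal E))$ be a densely defined, closed, non-negative definite symmetric bilinear form on $L_0^2(\mu)$, and let $(\mathcal C,\mathrm{Dom}(\mathcal C))$ be the non-positive self-adjoint linear operator on $\mathbb H^l$ that is the generator of $\mathcal E$ restricted to $\mathbb H^l$. Assume that there are constants $m,C\in(0,\infty)$ with $$\mathcal E(g,g)\ \ge\ m\|g\|^2\quad\text{for all }g\in\mathrm{Dom}(\mathcal E)\cap\mathbb H^l,$$ $$\mathcal E(f,g)\ \le\ C\|f\|\,\|\mathcal Cg\|\quad\text{for all }f\in\mathrm{Dom}(\mathcal E)\cap\mathbb H^h,\ g\in\mathrm{Dom}(\mathcal C).$$ Then $$\|f\|^2\ \le\ \frac2m\,\mathcal E(f,f)+(1+2C^2)\|f-\Pi f\|^2$$ for all $f\in\mathrm{Dom}(\mathcal E)$ with $\Pi f\in\mathrm{Dom}(\mathcal E)$.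
   Context: $\mu$ is a probability measure on a Polish space $S$; $L^2_0(\mu)=\{f\in L^2(\mu):\int f\,\mathrm d\mu=0\}$ with the $L^2(\mu)$ inner product $\langle\cdot,\cdot\rangle$ and norm $\|\cdot\|$. The restriction of $\mathcal E$ to $\mathbb H^l$, with domain $\mathrm{Dom}(\mathcal E)\cap\mathbb H^l$, is assumed to be densely defined in $\mathbb H^l$ (it is then a closed form there). Its generator $\mathcal C$ is defined by $\mathrm{Dom}(\mathcal C)=\{g\in\mathrm{Dom}(\mathcal E)\cap\mathbb H^l:\exists h\in\mathbb H^l\text{ with }\mathcal E(f,g)=\langle f,h\rangle\text{ for all }f\in\mathrm{Dom}(\mathcal E)\cap\mathbb H^l\}$ and $-\mathcal Cg=h$. *)

(* Defs.v *)
From HB Require Import structures.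
From mathcomp Require Import all_boot all_order all_algebra.
From mathcomp Require Import all_classical all_reals all_analysis.
From mathcomp Require Import measurable_realfun ess_sup_inf.

Set Implicit Arguments.
Unset Strict Implicit.
Unset Printing Implicit Defensive.
Import Order.TTheory GRing.Theory Num.Theory.
Import numFieldNormedType.Exports.

Local Open Scope classical_set_scope.
Local Open Scope ring_scope.

Definition polish_space (R : realType) (S : topologicalType) : Prop :=
  (exists2 A : set S, countable A & dense A) /\
  exists dist : S -> S -> R,
    [/\ (forall x y, 0 <= dist x y) /\ (forall x y, dist x y = 0 <-> x = y),
        forall x y, dist x y = dist y x,
        forall x y z, dist x z <= dist x y + dist y z,
        forall (x : S) (A : set S), nbhs x A <->
          exists2 e : R, 0 < e & [set y | dist x y < e] `<=` A
      & forall u : nat -> S,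
          (forall e : R, 0 < e -> exists N, forall i j,
             (N <= i)%N -> (N <= j)%N -> dist (u i) (u j) < e) ->
          exists x : S, u n @[n --> \oo] --> x].

(* The base point only supplies the nonemptiness that a space carrying a     *)
(* probability measure has anyway; measurable types are pointed.             *)
Definition borel (S : ptopologicalType) : measurableType _ :=
  g_sigma_algebraType (@open S).

(* The library's quotient LspaceType mu p1 of p-integrable functions modulo  *)
(* almost everywhere equality comes without operations. It is made here into *)
(* a normed module over R, with norm u |-> fine 'N[mu]_p[u]; u : LspaceType  *)
(* coerces to a representative T -> R.                                       *)
Section Lspace_normedModType.
Context d (T : measurableType d) (R : realType).
Variables (mu : {measure set T -> \bar R}) (p : \bar R) (p1 : (1 <= p)%E).

Local Notation L := (LspaceType mu p1).
Local Notation Lf := (LfunType mu p1).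
Local Notation Q := {mfun_ mu, T >-> measurableTypeR R}.

Lemma ae_eq_Lnorm (f g : T -> R) : measurable_fun setT f ->
  measurable_fun setT g -> f = g %[ae mu] ->
  'N[mu]_p[EFin \o f]%E = 'N[mu]_p[EFin \o g]%E.
Proof.
move=> mf mg fg; rewrite unlock /Lnorm; case: p p1 => [r r1|_|//].
  have mE (h : T -> R) : measurable_fun setT h ->
      measurable_fun setT ((fun x => `|(EFin \o h) x| `^ r)%E : T -> \bar R).
    move=> mh; apply: (measurableT_comp (measurable_poweR _)) => //.
    apply: measurableT_comp => //; exact/measurable_EFinP.
  congr (_ `^ _)%E; apply: ge0_ae_eq_integral => //.
  - exact: mE.
  - exact: mE.
  - by move=> x _; exact: poweR_ge0.
  - by move=> x _; exact: poweR_ge0.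
  - by apply: filterS fg => x /= fg _; rewrite fg.
case: ifPn => // _; apply: eq_ess_sup.
by apply: filterS fg => x /= -> .
Qed.

Lemma Lspace_measurable (u : L) : measurable_fun setT (u : T -> R).
Proof. exact: (@measurable_funPT _ _ _ _ (repr (LebesgueSpace.sort u))). Qed.

Lemma Lspace_Lfun (u : L) : (u : T -> R) \in Lfun mu p.
Proof.
rewrite inE; apply/andP; split; rewrite inE/=; first exact: Lspace_measurable.
exact: Lebesgue_finite.
Qed.

Lemma Lspace_ae_inj (u v : L) :
  (u : T -> R) = (v : T -> R) %[ae mu] -> u = v.
Proof.
move=> uv.
have : LebesgueSpace.sort u = LebesgueSpace.sort v.
  rewrite -[LHS]reprK -[RHS]reprK; apply/eqmodP; exact/asboolP.
case: u v {uv} => [u [[hu]]] [v [[hv]]] /= uv.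
by subst v; rewrite (Prop_irrelevance hu hv).
Qed.

Section Lspace_class.
Variables (f : T -> R) (fP : f \in Lfun mu p).

Let mf : @measurable_fun _ _ T (measurableTypeR R) setT f.
Proof. by move: fP; rewrite inE => /andP[]; rewrite inE. Qed.

Let fQ : {mfun T >-> measurableTypeR R} :=
  HB.pack f (isMeasurableFun.Build _ _ T (measurableTypeR R) f mf).

Let q : Q := \pi_Q%qT fQ.

Let qf : (q : T -> R) = f %[ae mu].
Proof.
have /eqmodP/asboolP : repr q = fQ %[mod Q]%qT by rewrite reprK.
by [].
Qed.

Let q_finite : finite_norm mu p q.
Proof.
rewrite /finite_norm (ae_eq_Lnorm _ _ qf)//.
  by move: fP; rewrite inE => /andP[_]; rewrite inE.
exact: (@measurable_funPT _ _ _ _ (repr q)).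
Qed.

Definition Lspace_class : L :=
  HB.pack q (isFinLebesgue.Build d T R mu p p1 q q_finite).

Lemma Lspace_classE : (Lspace_class : T -> R) = f %[ae mu].
Proof. exact: qf. Qed.

End Lspace_class.

HB.instance Definition _ := gen_eqMixin L.
HB.instance Definition _ := gen_choiceMixin L.

Let LfunD (u v : L) : (u : T -> R) \+ (v : T -> R) \in Lfun mu p.
Proof.
have [_ /(_ (u : T -> R) (v : T -> R))] := @Lfun_addr_closed _ _ _ mu p p1.
by apply; exact: Lspace_Lfun.
Qed.

Let LfunN (u : L) : \- (u : T -> R) \in Lfun mu p.
Proof.
have /(_ (u : T -> R)) := @Lfun_oppr_closed _ _ _ mu p.
by apply; exact: Lspace_Lfun.
Qed.

Let Lfun0 : (cst 0 : T -> R) \in Lfun mu p.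
Proof. by have [] := @Lfun_addr_closed _ _ _ mu p p1. Qed.

Let LfunZ (a : R) (u : L) : a \*: (u : T -> R) \in Lfun mu p.
Proof.
have [_ /(_ a (u : T -> R) (cst 0))] := @Lfun_submod_closed _ _ _ mu p p1.
rewrite (_ : a *: (u : T -> R) + cst 0 = a \*: (u : T -> R)).
  by apply; [exact: Lspace_Lfun|exact: Lfun0].
by apply/funext => x; rewrite /= -[RHS]addr0.
Qed.

Definition Lspace0 : L := Lspace_class Lfun0.
Definition Lspace_add (u v : L) : L := Lspace_class (LfunD u v).
Definition Lspace_opp (u : L) : L := Lspace_class (LfunN u).
Definition Lspace_scale (a : R) (u : L) : L := Lspace_class (LfunZ a u).

Let ae0 : \forall x \ae mu, (Lspace0 : T -> R) x = 0.
Proof. by apply: filterS (Lspace_classE Lfun0) => x; apply. Qed.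

Let aeD (u v : L) :
  \forall x \ae mu, (Lspace_add u v : T -> R) x = (u : T -> R) x + (v : T -> R) x.
Proof. by apply: filterS (Lspace_classE (LfunD u v)) => x; apply. Qed.

Let aeN (u : L) : \forall x \ae mu, (Lspace_opp u : T -> R) x = - (u : T -> R) x.
Proof. by apply: filterS (Lspace_classE (LfunN u)) => x; apply. Qed.

Let aeZ a (u : L) :
  \forall x \ae mu, (Lspace_scale a u : T -> R) x = a * (u : T -> R) x.
Proof. by apply: filterS (Lspace_classE (LfunZ a u)) => x; apply. Qed.

Let aeS4 (P1 P2 P3 P4 Q : T -> Prop) :
  (forall x, P1 x -> P2 x -> P3 x -> P4 x -> Q x) ->
  (\forall x \ae mu, P1 x) -> (\forall x \ae mu, P2 x) ->
  (\forall x \ae mu, P3 x) -> (\forall x \ae mu, P4 x) ->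
  \forall x \ae mu, Q x.
Proof.
move=> PQ p1x p2x p3x p4x; near=> x.
by apply: PQ; near: x.
Unshelve. all: by end_near. Qed.

Let LspaceDA : associative Lspace_add.
Proof.
move=> u v w; apply: Lspace_ae_inj.
move: (aeD u (Lspace_add v w)) (aeD v w) (aeD (Lspace_add u v) w) (aeD u v).
apply: aeS4 => x -> -> -> -> _; exact: addrA.
Qed.

Let LspaceDC : commutative Lspace_add.
Proof.
move=> u v; apply: Lspace_ae_inj; move: (aeD u v) (aeD v u).
apply: filterS2 => x -> -> _; exact: addrC.
Qed.

Let Lspace0D : left_id Lspace0 Lspace_add.
Proof.
move=> u; apply: Lspace_ae_inj; move: (aeD Lspace0 u) ae0.
apply: filterS2 => x -> -> _; exact: add0r.
Qed.

Let LspaceND : left_inverse Lspace0 Lspace_opp Lspace_add.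
Proof.
move=> u; apply: Lspace_ae_inj.
move: (aeD (Lspace_opp u) u) (aeN u) ae0.
apply: filterS3 => x -> -> -> _; exact: addNr.
Qed.

HB.instance Definition _ :=
  GRing.isZmodule.Build L LspaceDA LspaceDC Lspace0D LspaceND.

Let LspaceZA a b (u : L) :
  Lspace_scale a (Lspace_scale b u) = Lspace_scale (a * b) u.
Proof.
apply: Lspace_ae_inj.
move: (aeZ a (Lspace_scale b u)) (aeZ b u) (aeZ (a * b) u).
apply: filterS3 => x -> -> -> _; exact: mulrA.
Qed.

Let Lspace1Z : left_id 1 Lspace_scale.
Proof.
move=> u; apply: Lspace_ae_inj; move: (aeZ 1 u).
apply: filterS => x -> _; exact: mul1r.
Qed.

Let LspaceZDr : right_distributive Lspace_scale +%R.
Proof.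
move=> a u v; apply: Lspace_ae_inj.
have auv : \forall x \ae mu, (Lspace_add (Lspace_scale a u) (Lspace_scale a v)
    : T -> R) x = a * (u : T -> R) x + a * (v : T -> R) x.
  move: (aeD (Lspace_scale a u) (Lspace_scale a v)) (aeZ a u) (aeZ a v).
  by apply: filterS3 => x -> -> ->.
move: (aeZ a (Lspace_add u v)) (aeD u v) auv.
apply: filterS3 => x -> -> -> _; exact: mulrDr.
Qed.

Let LspaceZDl (u : L) : {morph Lspace_scale^~ u : a b / a + b}.
Proof.
move=> a b; apply: Lspace_ae_inj.
move: (aeZ (a + b) u) (aeD (Lspace_scale a u) (Lspace_scale b u))
  (aeZ a u) (aeZ b u).
apply: aeS4 => x -> -> -> -> _; exact: mulrDl.
Qed.

HB.instance Definition _ := GRing.Zmodule_isLmodule.Build R L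
  LspaceZA Lspace1Z LspaceZDr LspaceZDl.

Lemma Lspace0E : \forall x \ae mu, ((0 : L) : T -> R) x = 0.
Proof. exact: ae0. Qed.

Lemma LspaceDE (u v : L) :
  \forall x \ae mu, (u + v : L) x = (u : T -> R) x + (v : T -> R) x.
Proof. exact: aeD. Qed.

Lemma LspaceNE (u : L) : \forall x \ae mu, (- u : L) x = - (u : T -> R) x.
Proof. exact: aeN. Qed.

Lemma LspaceZE a (u : L) : \forall x \ae mu, (a *: u : L) x = a * (u : T -> R) x.
Proof. exact: aeZ. Qed.

Definition Lspace_norm (u : L) : R := fine 'N[mu]_p[EFin \o (u : T -> R)].

Let Lspace_normE (u : L) (f : T -> R) (fP : f \in Lfun mu p) :
  (\forall x \ae mu, (u : T -> R) x = f x) ->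
  (Lspace_norm u)%:E = 'N[mu]_p[EFin \o f]%E.
Proof.
move=> uf; rewrite -(@ae_eq_Lnorm (u : T -> R) f).
- exact: (finite_norm_fine (Lfun_Sub p1 (Lspace_Lfun u))).
- exact: Lspace_measurable.
- by move: fP; rewrite inE => /andP[]; rewrite inE.
- by apply: filterS uf.
Qed.

Let Lspace_normD (u v : L) :
  Lspace_norm (u + v) <= Lspace_norm u + Lspace_norm v.
Proof.
rewrite -lee_fin EFinD (Lspace_normE (LfunD u v) (aeD u v)).
rewrite (Lspace_normE (Lspace_Lfun u)); last exact: aeW.
rewrite (Lspace_normE (Lspace_Lfun v)); last exact: aeW.
by apply: eminkowski => //; exact: Lspace_measurable.
Qed.

Let Lspace_normZ a (u : L) : Lspace_norm (a *: u) = `|a| * Lspace_norm u.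
Proof.
apply: EFin_inj; rewrite EFinM (Lspace_normE (LfunZ a u) (aeZ a u)).
rewrite (Lspace_normE (Lspace_Lfun u)); last exact: aeW.
exact: (LnormZ (Lfun_Sub p1 (Lspace_Lfun u))).
Qed.

Let Lspace_norm_eq0 (u : L) : Lspace_norm u = 0 -> u = 0.
Proof.
move=> u0; apply: Lspace_ae_inj.
have := @fine_Lnormr_eq0 _ _ _ mu p p1 (Lfun_Sub p1 (Lspace_Lfun u)) u0.
move: ae0 => /[swap]; apply: filterS2 => x ux -> _; exact: ux.
Qed.

HB.instance Definition _ :=
  @Lmodule_isNormed.Build R L Lspace_norm Lspace_normD Lspace_normZ Lspace_norm_eq0.
End Lspace_normedModType.

Section L2_forms.
Context d (T : measurableType d) (R : realType) (mu : probability T R).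

Local Notation L2 := (LspaceType2 mu).
Implicit Types (f g h : L2) (V H D : set L2).

Definition L2_inner f g : R := \int[mu]_x ((f : T -> R) x * (g : T -> R) x).

Lemma L2_integrable f g :
  mu.-integrable setT (EFin \o ((f : T -> R) \* (g : T -> R))).
Proof. by apply/Lfun1_integrable/Lfun2_mul_Lfun1; exact: Lspace_Lfun. Qed.

Lemma L2_innerC f g : L2_inner f g = L2_inner g f.
Proof. by apply: eq_Rintegral => x _; exact: mulrC. Qed.

Lemma L2_innerDl f g h : L2_inner (f + g) h = L2_inner f h + L2_inner g h.
Proof.
rewrite /L2_inner -RintegralD//; [|exact: L2_integrable..].
congr fine; apply: ae_eq_integral => //.
- by have /integrableP[] := L2_integrable (f + g) h.
- by have /integrableP[] := integrableD measurableT (L2_integrable f h) (L2_integrable g h).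
- by apply: filterS (LspaceDE f g) => x /= -> _; rewrite mulrDl.
Qed.

Lemma L2_innerZl a f h : L2_inner (a *: f) h = a * L2_inner f h.
Proof.
rewrite /L2_inner -RintegralZl//; last exact: L2_integrable.
congr fine; apply: ae_eq_integral => //.
- by have /integrableP[] := L2_integrable (a *: f) h.
- by have /integrableP[] := integrableZl measurableT a (L2_integrable f h).
- by apply: filterS (LspaceZE a f) => x /= -> _; rewrite mulrA.
Qed.

Lemma L2_innerff f : L2_inner f f = `|f| ^+ 2.
Proof.
apply: EFin_inj; rewrite /L2_inner /Rintegral fineK; last first.
  exact: integrable_fin_num (L2_integrable f f).
have fE : (`|f|%:E = 'N[mu]_2%:E[EFin \o (f : T -> R)])%E.
  exact: (finite_norm_fine (Lfun_Sub (lee1n 2) (Lspace_Lfun f))).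
rewrite -powR_mulrn// -poweR_EFin fE powR_Lnorm//.
apply: eq_integral => x _.
by rewrite /= powR_mulrn// real_normK ?num_real// expr2.
Qed.

Definition L2_0 : set L2 := [set f | \int[mu]_x (f : T -> R) x = 0].

Definition subspace_of V H : Prop := H `<=` V /\ submod_closed (mem H).

Definition dense_in V H : Prop := H `<=` V /\ V `<=` closure H.

Definition orthogonal_decomposition V Hl Hh : Prop :=
  [/\ subspace_of V Hl /\ closed Hl,
      subspace_of V Hh /\ closed Hh,
      forall f g, Hl f -> Hh g -> L2_inner f g = 0
    & forall f, V f -> exists g h, [/\ Hl g, Hh h & f = g + h]].

Definition orthogonal_projection V H (Pi : L2 -> L2) : Prop :=
  forall f, V f -> H (Pi f) /\ forall g, H g -> L2_inner (f - Pi f) g = 0.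

(* A form is a pair of a domain D and a function E on L2 x L2, whose values  *)
(* outside of D x D are irrelevant.                                          *)
Definition symmetric_nonneg_form V D (E : L2 -> L2 -> R) : Prop :=
  [/\ subspace_of V D,
      forall a f g h, D f -> D g -> D h ->
        E (a *: f + g) h = a * E f h + E g h,
      forall f g, D f -> D g -> E f g = E g f
    & forall f, D f -> 0 <= E f f].

(* D is complete for the norm f |-> (E f f + |f|^2)^(1/2).                   *)
Definition closed_form D (E : L2 -> L2 -> R) : Prop :=
  let E1 f := E f f + `|f| ^+ 2 in
  forall u : nat -> L2, (forall n, D (u n)) ->
    (forall e : R, 0 < e -> exists N, forall i j,
       (N <= i)%N -> (N <= j)%N -> E1 (u i - u j) < e) ->
    exists2 f, D f & E1 (u n - f) @[n --> \oo] --> (0 : R).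

(* Graph {(g, h) | h = - generator g}; the domain of the restriction of      *)
(* (E, D) to H is D `&` H, and the generator is well defined by              *)
(* generator_graph_unique when the latter is dense in H.                     *)
Definition generator_graph H D (E : L2 -> L2 -> R) g h : Prop :=
  [/\ (D `&` H) g, H h & forall f, (D `&` H) f -> E f g = L2_inner f h].

Definition generator_dom H D (E : L2 -> L2 -> R) : set L2 :=
  [set g | exists h, generator_graph H D E g h].

Lemma generator_graph_unique H D (E : L2 -> L2 -> R) g h h' :
  submod_closed (mem H) -> H `<=` closure (D `&` H) ->
  generator_graph H D E g h -> generator_graph H D E g h' -> h = h'.
Proof.
move=> [_ Hlin] Hcl [_ Hh Eh] [_ Hh' Eh'].
pose k := h - h'.
have Hk : H k.
  apply: set_mem; rewrite /k addrC -scaleN1r; apply: Hlin; exact: mem_set.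
have k_orth f : (D `&` H) f -> L2_inner f k = 0.
  move=> Df; rewrite L2_innerC /k addrC -scaleN1r L2_innerDl L2_innerZl.
  by rewrite !(L2_innerC _ f) -Eh// -Eh'// mulN1r addNr.
apply/eqP; rewrite -subr_eq0 -/k -normr_le0; clearbody k.
apply/ler_addgt0Pr => e e0; rewrite add0r.
have [f [Df]] := Hcl _ Hk _ (nbhsx_ballx _ _ e0).
rewrite -ball_normE /= => /ltW; apply: le_trans.
rewrite -ler_sqr ?nnegrE// -!L2_innerff.
rewrite [leRHS](_ : _ = L2_inner k k + L2_inner f f).
  by rewrite lerDl L2_innerff exprn_ge0.
rewrite -scaleN1r L2_innerDl L2_innerZl !(L2_innerC _ (k + _)).
rewrite !L2_innerDl !L2_innerZl (L2_innerC k f) (k_orth f)//.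
by rewrite !mulr0 add0r addr0 mulrA mulrNN !mul1r.
Qed.

Definition generator H D (E : L2 -> L2 -> R) g : L2 :=
  - xget 0 [set h | generator_graph H D E g h].

End L2_forms.
Arguments L2_0 {d T R} mu.

(* Main.v *)
(* Write f = l + k with l = Pi f and k in Hh. Coercivity of E on Hl makes the
   generator of the restricted form onto, so that some g in its domain satisfies
   E(u, g) = <u, l> on Dom(E) `&` Hl. Then
     |l|^2 = E(l, g) = E(f, g) + E(-k, g)
           <= E(f, f)^(1/2) E(g, g)^(1/2) + C |k| |l|,
   and m E(g, g) <= |l|^2 because E(g, g) = <g, l> <= |g| |l|. Dividing by |l|
   and squaring bounds |l|^2 by 2/m E(f, f) + 2 C^2 |k|^2. *)
Require Import Defs.
From HB Require Import structures.
From mathcomp Require Import all_boot all_order all_algebra.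
From mathcomp Require Import all_classical all_reals all_analysis.
From mathcomp Require Import ring lra.

Set Implicit Arguments.
Unset Strict Implicit.
Unset Printing Implicit Defensive.
Import Order.TTheory GRing.Theory Num.Theory.
Import numFieldNormedType.Exports.

Local Open Scope classical_set_scope.
Local Open Scope ring_scope.

(** For [a > 0], evaluate at the minimizer [- b / a]. The case [a = 0] covers degenerate forms: an
    affine function that is non-negative everywhere has slope zero. *)
Lemma discriminant_le (R : realFieldType) (a b c : R) : 0 <= a ->
  (forall t, 0 <= t ^+ 2 * a + 2 * t * b + c) -> b ^+ 2 <= a * c.
Proof.
rewrite le_eqVlt => /predU1P[<- H|a0 H].
  have [->|b0] := eqVneq b 0; first by rewrite expr0n /= mul0r.
  (* This [t] gives the affine function the value -1. *)
  have := H (- (c + 1) / (2 * b)).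
  have -> : 2 * (- (c + 1) / (2 * b)) * b = - (c + 1) by field.
  by rewrite mulr0; lra.
have := H (- b / a).
rewrite -(pmulr_rge0 _ a0).
have -> : a * ((- b / a) ^+ 2 * a + 2 * (- b / a) * b + c) = a * c - b ^+ 2.
  by field; rewrite gt_eqF.
by rewrite subr_ge0.
Qed.

Lemma subspaceZD (R : nzRingType) (V : lmodType R) (H : set V) a f g :
  submod_closed (mem H) -> H f -> H g -> H (a *: f + g).
Proof.
move=> [_ Hlin] Hf Hg; apply: set_mem; apply: Hlin; exact: mem_set.
Qed.

Lemma subspaceN (R : nzRingType) (V : lmodType R) (H : set V) f :
  submod_closed (mem H) -> H f -> H (- f).
Proof.
move=> HH Hf; rewrite -scaleN1r -[_ *: _]addr0; apply: subspaceZD => //.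
by case: HH => /set_mem.
Qed.

Lemma subspaceB (R : nzRingType) (V : lmodType R) (H : set V) f g :
  submod_closed (mem H) -> H f -> H g -> H (f - g).
Proof. by move=> HH Hf Hg; rewrite addrC -scaleN1r; exact: subspaceZD. Qed.

Section forms.
Context d (T : measurableType d) (R : realType) (mu : probability T R).
Local Notation L2 := (LspaceType2 mu).
Implicit Types (f g h l : L2) (V H D : set L2) (E : L2 -> L2 -> R).

Lemma form_quadratic V D E a f g : symmetric_nonneg_form V D E -> D f -> D g ->
  E (a *: f + g) (a *: f + g) = a ^+ 2 * E f f + 2 * a * E f g + E g g.
Proof.
move=> [[_ subD] lin sym _] Df Dg.
have Dfg : D (a *: f + g) by exact: subspaceZD.
rewrite lin// (sym f (a *: f + g))// (sym g (a *: f + g))//.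
by rewrite !lin// (sym g f)//; ring.
Qed.

Lemma form_cauchy_schwarz V D E f g : symmetric_nonneg_form V D E ->
  D f -> D g -> E f g ^+ 2 <= E f f * E g g.
Proof.
move=> formE Df Dg; have [[_ subD] _ _ pos] := formE.
apply: discriminant_le => [|t]; first exact: pos.
by rewrite -(form_quadratic _ formE)//; apply: pos; exact: subspaceZD.
Qed.

Lemma form0l V D E f : symmetric_nonneg_form V D E -> D f -> E 0 f = 0.
Proof.
move=> [_ lin _ _] Df.
by rewrite -[0](addNr f) -scaleN1r lin// mulN1r addNr.
Qed.

(** Makes the expansion and Cauchy-Schwarz lemmas for forms available for the inner product. *)
Lemma L2_inner_form : symmetric_nonneg_form setT setT (@L2_inner _ T R mu).
Proof.
split=> //.
- by split=> //; split=> [|a f g _ _]; exact: mem_set.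
- by move=> a f g h _ _ _; rewrite L2_innerDl L2_innerZl.
- by move=> f g _ _; exact: L2_innerC.
- by move=> f _; rewrite L2_innerff exprn_ge0.
Qed.

Lemma L2_inner_sqr_le f g : L2_inner f g ^+ 2 <= `|f| ^+ 2 * `|g| ^+ 2.
Proof.
rewrite -!L2_innerff; exact: form_cauchy_schwarz L2_inner_form _ _.
Qed.

(** If [f = g + h] is the decomposition, then [g - Pi f] lies in [Hl] and is orthogonal to both
    [f - Pi f] and [h], hence to their difference, which is itself. *)
Lemma orthogonal_decompositionB V Hl Hh Pi f :
  orthogonal_decomposition V Hl Hh -> orthogonal_projection V Hl Pi ->
  V f -> Hh (f - Pi f).
Proof.
move=> [[[_ subl] _] _ orth dec] proj Vf.
have [HPi Pi0] := proj _ Vf.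
have [g [h [Hg Hh_ fE]]] := dec _ Vf.
have Hgf : Hl (g - Pi f) by exact: subspaceB.
have := Pi0 _ Hgf.
have -> : f - Pi f = (g - Pi f) + h by rewrite fE addrAC.
rewrite L2_innerDl (L2_innerC h) (orth _ _ Hgf Hh_) addr0 L2_innerff.
by move=> /eqP; rewrite expf_eq0 /= normr_eq0 => /eqP ->; rewrite add0r.
Qed.

(* g minimizes J u = E u u - 2 <u, l> over D `&` H: by the parallelogram
   identity minimizing sequences are Cauchy for E, hence converge in D. *)
Lemma generator_graph_surj V D E H m l :
  symmetric_nonneg_form V D E -> closed_form D E ->
  submod_closed (mem H) -> closed H -> 0 < m ->
  (forall g, (D `&` H) g -> m * `|g| ^+ 2 <= E g g) ->
  H l -> exists g, generator_graph H D E g l.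
Proof.
move=> formE closedE subH closedH m0 coer Hl.
have [[_ subD] lin sym pos] := formE.
pose W := D `&` H.
pose J u := E u u - 2 * L2_inner u l.
have WZD a f g : W f -> W g -> W (a *: f + g).
  by move=> [Df Hf] [Dg Hg]; split; exact: subspaceZD.
(* The coefficient of [2 * t] is the derivative term that must vanish at a minimizer. *)
have JZD t f g : W f -> W g ->
    J (t *: f + g) = t ^+ 2 * E f f + 2 * t * (E f g - L2_inner f l) + J g.
  move=> [Df _] [Dg _].
  by rewrite /J (form_quadratic _ formE)// L2_innerDl L2_innerZl; ring.
have W0 : W 0 by split; apply: set_mem; [case: subD|case: subH].
have J0 : J 0 = 0.
  by rewrite /J (form0l formE W0.1) (form0l L2_inner_form)// mulr0 subr0.
have Jlb u : W u -> - (`|l| ^+ 2 / m) <= J u.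
  move=> Wu; have := coer _ Wu; have := pos _ Wu.1 => pu cu.
  have cs : L2_inner u l ^+ 2 <= E u u * (`|l| ^+ 2 / m).
    rewrite mulrA ler_pdivlMr//.
    have := ler_wpM2r (ltW m0) (L2_inner_sqr_le u l).
    have := ler_wpM2r (exprn_ge0 2 (normr_ge0 l)) cu; lra.
  rewrite /J; set a := E u u in pu cs *; set b := L2_inner u l in cs *.
  set c := `|l| ^+ 2 / m in cs *.
  have c0 : 0 <= c by rewrite divr_ge0 ?exprn_ge0// ltW.
  suff : 2 * b <= a + c by lra.
  have [b0|b0] := leP b 0; first by lra.
  rewrite -ler_sqr ?nnegrE; [|lra|lra].
  (* From [b ^+ 2 <= a * c] and [4 * a * c <= (a + c) ^+ 2]. *)
  have := sqr_ge0 (a - c); nra.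
have infJ : has_inf (J @` W).
  split; first by exists 0, 0.
  by exists (- (`|l| ^+ 2 / m)) => _ [u Wu <-]; exact: Jlb.
pose j := inf (J @` W).
have jJ u : W u -> j <= J u.
  by move=> Wu; apply: ge_inf; [exact: infJ.2|exists u].
have /choice[u uP] n : exists u, W u /\ J u < j + n.+1%:R^-1.
  have n0 : 0 < n.+1%:R^-1 :> R by rewrite invr_gt0.
  have [_ [u Wu <-] Ju] := inf_adherent n0 infJ.
  by exists u.
have Edist n k : E (u n - u k) (u n - u k) <= 2 * n.+1%:R^-1 + 2 * k.+1%:R^-1.
  have [[Dn Hn] Jn] := uP n; have [[Dk Hk] Jk] := uP k.
  (* The midpoint of [u n] and [u k], in the shape that [JZD] expands. Since [J] is at least [j]
     there, E(u n - u k, u n - u k) = 2 J(u n) + 2 J(u k) - 4 J(midpoint) gives the bound. *)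
  have Wk : W (2^-1 *: u k + 0) by exact: WZD.
  have := jJ _ (WZD 2^-1 _ _ (conj Dn Hn) Wk).
  rewrite !JZD// J0 (sym (u n))//; last exact: Wk.1.
  rewrite lin//; last exact: W0.1.
  rewrite (sym (u k) 0) ?(form0l formE)//; last exact: W0.1.
  rewrite (_ : u n - u k = (-1) *: u k + u n); last by rewrite scaleN1r addrC.
  rewrite (form_quadratic _ formE)//.
  move: Jn Jk; rewrite /J.
  move: (n.+1%:R^-1) (k.+1%:R^-1) => a b.
  lra.
have Winv e : 0 < e -> exists N : nat, N.+1%:R^-1 < e :> R.
  by move=> e0; have [N _ /(_ N (leqnn N))] := near_infty_natSinv_lt (PosNum e0); exists N.
have Wu n : W (u n) := (uP n).1.
have [n|e e0|g Dg] := closedE u; first exact: (Wu n).1.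
  have m1 : 0 < 1 + m^-1 by rewrite addr_gt0// invr_gt0.
  (* Coercivity bounds the squared norm by [m^-1] times the form, whence [1 + m^-1]; the 4 is the
     sum of the two factors 2 in [Edist]. *)
  have e1 : 0 < e / (1 + m^-1) / 4 by rewrite !divr_gt0.
  have [N Ne] := Winv _ e1.
  exists N => i k Ni Nk.
  have Wik : W (u i - u k).
    by have [[? ?] [? ?]] := (Wu i, Wu k); split; exact: subspaceB.
  have cik := coer _ Wik.
  have Ninv p : (N <= p)%N -> p.+1%:R^-1 <= N.+1%:R^-1 :> R.
    by move=> Np; rewrite lef_pV2 ?posrE// ler_nat.
  have E4 : E (u i - u k) (u i - u k) <= 4 * N.+1%:R^-1.
    move: (Edist i k) (Ninv i Ni) (Ninv k Nk).
    move: (i.+1%:R^-1) (k.+1%:R^-1) (N.+1%:R^-1) => a b c; lra.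
  apply: (@le_lt_trans _ _ ((1 + m^-1) * E (u i - u k) (u i - u k))).
    by rewrite mulrDl mul1r lerD2l mulrC ler_pdivlMr// mulrC.
  rewrite mulrC -ltr_pdivlMr//; apply: (le_lt_trans E4).
  by rewrite mulrC -ltr_pdivlMr.
move=> ug.
have Dug n : D (u n - g) by apply: subspaceB => //; exact: (Wu n).1.
have ug_lt e : 0 < e -> exists2 n, n.+1%:R^-1 < e &
    E (u n - g) (u n - g) + `|u n - g| ^+ 2 < e.
  move=> e0.
  have [N _ HN] := near_infty_natSinv_lt (PosNum e0).
  have /cvgrPdist_lt/(_ _ e0)[M _ HM] := ug.
  exists (maxn N M); first by apply: HN; exact: leq_maxl.
  have := HM _ (leq_maxr N M); rewrite /= sub0r normrN; apply: le_lt_trans.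
  exact: ler_norm.
have Hg : H g.
  apply: closedH => A /nbhs_ballP[e /= e0 eA].
  have [n _ un] := ug_lt _ (exprn_gt0 2 e0).
  exists (u n); split; first exact: (Wu n).2.
  apply: eA; rewrite -ball_normE /= distrC.
  rewrite -(ltr_pXn2r (n := 2))// ?nnegrE ?(ltW e0)//.
  by apply: le_lt_trans un; rewrite lerDr pos.
exists g; split=> // f [Df Hf].
apply/eqP; rewrite -subr_eq0 -sqrf_eq0 eq_le sqr_ge0 andbT.
apply/ler_addgt0Pr => e e0; rewrite add0r.
have p0 := pos _ Df.
(* Both errors in passing through [E f (u n)] will have squares at most [e / 4]; the [+ 1] keeps the
   denominator positive when [E f f = 0]. *)
have e1 : 0 < e / (4 * (E f f + 1)) by rewrite divr_gt0// mulr_gt0// ltr_wpDl.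
have [n ne une] := ug_lt _ e1.
(* Approximate Euler-Lagrange equation: moving from [u n] by [t *: f] lowers [J] by less than
   [n.+1%:R^-1], for every [t]. *)
have b1 : (E f (u n) - L2_inner f l) ^+ 2 <= E f f * n.+1%:R^-1.
  apply: discriminant_le => // t.
  have := jJ _ (WZD t _ _ (conj Df Hf) (Wu n)).
  rewrite JZD//; have := (uP n).2; move: (n.+1%:R^-1) => r; lra.
have b2 := form_cauchy_schwarz formE Df (Dug n).
have : E f (u n - g) = E f (u n) - E f g.
  have Du := (Wu n).1.
  rewrite (sym f)// -[u n - g]addrC -scaleN1r lin//.
  by rewrite (sym g)// (sym (u n))// mulN1r addrC.
move=> b3; rewrite b3 in b2.
have q0 : 0 <= `|u n - g| ^+ 2 by exact: exprn_ge0.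
have s3 : E f f * (e / (4 * (E f f + 1))) <= e / 4.
  rewrite [leRHS](_ : _ = (E f f + 1) * (e / (4 * (E f f + 1)))); last first.
    by field; lra.
  by apply: ler_wpM2r; [exact: ltW|lra].
have {}b1 : (E f (u n) - L2_inner f l) ^+ 2 <= e / 4.
  by rewrite (le_trans b1)// (le_trans _ s3)// ler_wpM2l// ltW.
have {}b2 : (E f (u n) - E f g) ^+ 2 <= e / 4.
  by rewrite (le_trans b2)// (le_trans _ s3)// ler_wpM2l//; lra.
(* Yields (x - y)^2 <= 2 x^2 + 2 y^2 for the two errors, whose difference is
   [E f g - L2_inner f l]. *)
have := sqr_ge0 ((E f (u n) - L2_inner f l) + (E f (u n) - E f g)).
move: b1 b2; lra.
Qed.

Lemma generatorE H D E g h :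
  submod_closed (mem H) -> H `<=` closure (D `&` H) ->
  generator_graph H D E g h -> generator H D E g = - h.
Proof.
move=> subH dH gh; rewrite /generator; congr (- _).
exact: generator_graph_unique (xgetPex 0 (ex_intro _ h gh)) gh.
Qed.

End forms.

Theorem theorem17 (R : realType) (S : ptopologicalType)
  (polS : polish_space R S) (mu : probability (borel S) R)
  (Hl Hh : set (LspaceType2 mu)) (Pi : LspaceType2 mu -> LspaceType2 mu)
  (domE : set (LspaceType2 mu)) (E : LspaceType2 mu -> LspaceType2 mu -> R)
  (m C : R)
  (decomp : orthogonal_decomposition (L2_0 mu) Hl Hh)
  (projPi : orthogonal_projection (L2_0 mu) Hl Pi)
  (formE : symmetric_nonneg_form (L2_0 mu) domE E)
  (denseE : dense_in (L2_0 mu) domE)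
  (closedE : closed_form domE E)
  (denseEl : dense_in Hl (domE `&` Hl))
  (m_gt0 : 0 < m) (C_gt0 : 0 < C)
  (poincare_l : forall g, (domE `&` Hl) g -> m * `|g| ^+ 2 <= E g g)
  (cross_bound : forall f g, (domE `&` Hh) f -> generator_dom Hl domE E g ->
     E f g <= C * `|f| * `|generator Hl domE E g|) :
  forall f, domE f -> domE (Pi f) ->
    `|f| ^+ 2 <= 2 / m * E f f + (1 + 2 * C ^+ 2) * `|f - Pi f| ^+ 2.
Proof.
move=> f Df DPf.
have [[_ subD] lin sym pos] := formE.
have [[[_ subl] cll] [[_ subh] _] orth _] := decomp.
have V0f : L2_0 mu f by exact: denseE.1.
have Hlf : Hl (Pi f) := (projPi f V0f).1.
have Hhk := orthogonal_decompositionB decomp projPi V0f.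
set l := Pi f in DPf Hlf Hhk *; set k := f - l in Hhk *.
have fE : f = l + k by rewrite addrC subrK.
have Dk : domE k by exact: subspaceB.
have [g gP] := generator_graph_surj formE closedE subl cll m_gt0 poincare_l Hlf.
have [[Dg Hg] _ gE] := gP.
(* The bound is one-sided, so it is applied to [- k], the vector occurring in [l = f - k]. *)
have := cross_bound (- k) g (conj (subspaceN subD Dk) (subspaceN subh Hhk))
  (ex_intro _ _ gP).
rewrite (generatorE subl denseEl.2 gP) !normrN => cross.
have normf : `|f| ^+ 2 = `|l| ^+ 2 + `|k| ^+ 2.
  have := @form_quadratic _ _ _ _ _ _ _ 1 l k (L2_inner_form mu) I I.
  by rewrite scale1r -fE (orth _ _ Hlf Hhk) -!L2_innerff => ->; ring.
have normlE : `|l| ^+ 2 = E f g + E (- k) g.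
  have -> : E f g + E (- k) g = E l g.
    rewrite (_ : l = 1 *: f + (- k)); last by rewrite fE scale1r addrK.
    by rewrite lin ?mul1r//; exact: subspaceN.
  by rewrite gE// L2_innerff.
have Eg_le : m * E g g <= `|l| ^+ 2.
  have gg : E g g = L2_inner g l by exact: gE.
  have := L2_inner_sqr_le g l; rewrite -gg => cs.
  have := poincare_l g (conj Dg Hg) => pg.
  (* The positive case multiplies the goal by [E g g], so as to use [cs] and then [pg]. *)
  have [g0|g0] := leP (E g g) 0.
    by apply: le_trans (exprn_ge0 2 (normr_ge0 l)); rewrite pmulr_rle0.
  rewrite -(ler_pM2r g0) [leRHS]mulrC -mulrA -expr2.
  apply: (le_trans (ler_wpM2l (ltW m_gt0) cs)).
  by rewrite mulrA ler_wpM2r// exprn_ge0.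
have Efg := form_cauchy_schwarz formE Df Dg.
have Ef := pos _ Df.
have {Efg}Efg : E f g ^+ 2 <= (E f f / m) * `|l| ^+ 2.
  apply: (le_trans Efg); rewrite -mulrA ler_wpM2l//.
  by rewrite ler_pdivlMl.
(* By [normf], the remaining [k] term supplies the 1 in [1 + 2 * C ^+ 2]. *)
suff : `|l| ^+ 2 <= 2 / m * E f f + 2 * C ^+ 2 * `|k| ^+ 2 by lra.
have [->|l0] := eqVneq `|l| 0.
  by rewrite expr0n addr_ge0 // !mulr_ge0 ?invr_ge0 ?exprn_ge0 // ltW.
have {}l0 : 0 < `|l| by rewrite lt_def l0 normr_ge0.
have kl : 0 <= C * `|k| * `|l| by rewrite !mulr_ge0// ltW.
have nl : 0 <= `|l| ^+ 2 by rewrite exprn_ge0.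
rewrite -(ler_pM2r (exprn_gt0 2 l0)).
(* The absolute value makes the right-hand base non-negative, so that squaring is monotone. *)
have E2 : (`|l| ^+ 2) ^+ 2 <= (`|E f g| + C * `|k| * `|l|) ^+ 2.
  by rewrite ler_sqr ?nnegrE// ?addr_ge0// {1}normlE lerD// ler_norm.
rewrite -expr2; apply: (le_trans E2).
rewrite -[E f g ^+ 2]real_normK ?num_real// in Efg.
(* From (x + y)^2 <= 2 x^2 + 2 y^2 come the factors 2 in the final constants. *)
have := sqr_ge0 (`|E f g| - C * `|k| * `|l|).
move: Efg; lra.
Qed.
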